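(* Let $\mathrm{cl}_1$ and $\mathrm{cl}_2$ be closure operators on disjoint finite sets $V_1$ and $V_2$, and let $A$ be a finite alphabet with $|A|\ge2$. The following are equivalent: (a) $\mathrm{cl}_1$ and $\mathrm{cl}_2$ are solvable over $A$; (b) the disjoint union $\mathrm{cl}_1\cup\mathrm{cl}_2$ is solvable over $A$; (c) the unidirectional union $\mathrm{cl}_1\,\vec{\cup}\,\mathrm{cl}_2$ is solvable over $A$.
   Context: With $V=V_1\cup V_2$ and $X_i=X\cap V_i$ for $X\subseteq V$, the disjoint union and unidirectional union are the closure operators on $V$ given by $(\mathrm{cl}_1\cup\mathrm{cl}_2)(X)=\mathrm{cl}_1(X_1)\cup\mathrm{cl}_2(X_2)$, and $(\mathrm{cl}_1\,\vec{\cup}\,\mathrm{cl}_2)(X)=V_1\cup\mathrm{cl}_2(X_2)$ if $\mathrm{cl}_1(X_1)=V_1$, and $=\mathrm{cl}_1(X_1)\cup X_2$ otherwise. For a closure operator $\mathrm{cl}$ on a finite set $W$, the rank is $r=\min\{|b|: b\subseteq W,\ \mathrm{cl}(b)=W\}$. For a family $f=(f_v)_{v\in W}$ of partitions of $A^r$, $f_X$ ($X\subseteq W$) denotes the common refinement of the $f_v$, $v\in X$ (parts are the nonempty intersections of parts; $f_\emptyset$ has one part). A coding function for $\mathrm{cl}$ over $A$ is a family $f=(f_v)_{v\in W}$ of partitions of $A^r$, each into at most $|A|$ parts, such that $f_X=f_{\mathrm{cl}(X)}$ for all $X\subseteq W$. $\mathrm{cl}$ is solvable over $A$ if it has a coding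 function $f$ such that $f_W$ is the partition of $A^r$ into singletons. *)

(* Defs.v *)
From mathcomp Require Import all_boot.
Set Implicit Arguments.
Unset Strict Implicit.
Unset Printing Implicit Defensive.

Record closure_op (W : finType) := ClosureOp {
  cl_fun :> {set W} -> {set W};
  cl_ext : forall X : {set W}, X \subset cl_fun X;
  cl_mono : forall X Y : {set W}, X \subset Y -> cl_fun X \subset cl_fun Y;
  cl_idem : forall X : {set W}, cl_fun (cl_fun X) = cl_fun X
}.

(* The minimum is over a nonempty family: cl W = W for a closure operator. *)
Definition cl_rank (W : finType) (cl : closure_op W) : nat :=
  #|[arg min_(b < [set: W] | cl b == [set: W]) #|b|]|.

Definition refinement (W T : finType) (f : W -> {set {set T}}) (X : {set W}) :
    {set {set T}} :=
  [set B : {set T} | (B != set0) &&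
    [exists g : {ffun W -> {set T}},
      [forall v in X, g v \in f v] && (B == \bigcap_(v in X) g v)]].

(* A^r is rendered as r.-tuple A, with r the rank of cl. *)
Definition coding_function (W : finType) (cl : closure_op W) (A : finType)
    (f : W -> {set {set (cl_rank cl).-tuple A}}) : Prop :=
  [/\ forall v, partition (f v) [set: (cl_rank cl).-tuple A],
      forall v, #|f v| <= #|A|
    & forall X : {set W}, refinement f X = refinement f (cl X)].

Arguments coding_function {W} cl {A} f.

Definition cl_solvable (W : finType) (cl : closure_op W) (A : finType) : Prop :=
  exists f : W -> {set {set (cl_rank cl).-tuple A}},
    coding_function cl f /\
    refinement f [set: W] = [set [set x] | x : (cl_rank cl).-tuple A].

Arguments cl_solvable {W} cl A.

(* The union of the disjoint sets V1 and V2 is the sum type V1 + V2, so that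
   X_1 and X_2 are the preimages of X under the two injections. *)
Section Unions.
Variables (V1 V2 : finType) (cl1 : closure_op V1) (cl2 : closure_op V2).
Implicit Types (X Y : {set V1 + V2}) (S T : {set V1}) (P Q : {set V2}).

Definition lpart X : {set V1} := [set v | inl v \in X].
Definition rpart X : {set V2} := [set v | inr v \in X].
Definition join S P : {set V1 + V2} :=
  [set inl v | v in S] :|: [set inr v | v in P].

Lemma mem_join_l S P v : (inl v \in join S P) = (v \in S).
Proof.
rewrite !inE mem_imset; last by move=> ? ? [].
by case: imsetP => [[]|]; rewrite ?orbF.
Qed.

Lemma mem_join_r S P v : (inr v \in join S P) = (v \in P).
Proof.
rewrite !inE orbC mem_imset; last by move=> ? ? [].
by case: imsetP => [[]|]; rewrite ?orbF.
Qed.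

Lemma lpart_join S P : lpart (join S P) = S.
Proof. by apply/setP => v; rewrite inE mem_join_l. Qed.

Lemma rpart_join S P : rpart (join S P) = P.
Proof. by apply/setP => v; rewrite inE mem_join_r. Qed.

Lemma lpartS X Y : X \subset Y -> lpart X \subset lpart Y.
Proof. by move/subsetP => XY; apply/subsetP => v; rewrite !inE => /XY. Qed.

Lemma rpartS X Y : X \subset Y -> rpart X \subset rpart Y.
Proof. by move/subsetP => XY; apply/subsetP => v; rewrite !inE => /XY. Qed.

Lemma sub_join X T Q :
  lpart X \subset T -> rpart X \subset Q -> X \subset join T Q.
Proof.
move=> /subsetP s1 /subsetP s2; apply/subsetP => -[] v vX.
  by rewrite mem_join_l s1 // inE.
by rewrite mem_join_r s2 // inE.
Qed.

Lemma joinS S P T Q :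
  S \subset T -> P \subset Q -> join S P \subset join T Q.
Proof. by move=> s1 s2; apply: sub_join; rewrite ?lpart_join ?rpart_join. Qed.

Definition dunion_fun X : {set V1 + V2} :=
  join (cl1 (lpart X)) (cl2 (rpart X)).

Definition uunion_fun X : {set V1 + V2} :=
  if cl1 (lpart X) == [set: V1] then join [set: V1] (cl2 (rpart X))
  else join (cl1 (lpart X)) (rpart X).

Lemma dunion_ext X : X \subset dunion_fun X.
Proof. by apply: sub_join; apply: cl_ext. Qed.

Lemma dunion_mono X Y : X \subset Y -> dunion_fun X \subset dunion_fun Y.
Proof.
by move=> XY; apply: joinS; apply: cl_mono; [apply: lpartS|apply: rpartS].
Qed.

Lemma dunion_idem X : dunion_fun (dunion_fun X) = dunion_fun X.
Proof. by rewrite /dunion_fun lpart_join rpart_join !cl_idem. Qed.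

Lemma uunion_ext X : X \subset uunion_fun X.
Proof.
rewrite /uunion_fun; case: ifP => _; apply: sub_join;
  by rewrite ?subsetT ?subxx ?cl_ext.
Qed.

Lemma uunion_mono X Y : X \subset Y -> uunion_fun X \subset uunion_fun Y.
Proof.
move=> XY; have s1 := cl_mono cl1 (lpartS XY).
have s2 := rpartS XY; rewrite /uunion_fun.
case: ifP => [/eqP E|_].
  by rewrite E subTset in s1; rewrite s1 joinS ?cl_mono.
case: ifP => _; apply: joinS => //.
by apply: subset_trans s2 _; apply: cl_ext.
Qed.

Lemma uunion_idem X : uunion_fun (uunion_fun X) = uunion_fun X.
Proof.
rewrite {2 3}/uunion_fun; case: ifP => [_|E].
  have clT : cl1 [set: V1] = [set: V1].
    by apply/eqP; rewrite -subTset cl_ext.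
  by rewrite /uunion_fun lpart_join rpart_join clT eqxx cl_idem.
by rewrite /uunion_fun lpart_join rpart_join cl_idem E.
Qed.

Definition disjoint_union : closure_op (V1 + V2)%type :=
  ClosureOp dunion_ext dunion_mono dunion_idem.

Definition unidirectional_union : closure_op (V1 + V2)%type :=
  ClosureOp uunion_ext uunion_mono uunion_idem.

End Unions.

(* Main.v *)
Require Import Defs.
From mathcomp Require Import all_boot.

(** Replacing each partition f_v by a function into A with these fibers, a
    solution over A becomes a code: a set of |A|^r words in A^W in which the
    letters at X determine those at cl(X).  A code for any closure operator has
    at most |A|^r words.  The product of two codes is a code for the disjoint
    union, and a fortiori for the smaller unidirectional union, which has the
    same rank r1 + r2.  Conversely, for a code C of the unidirectional union,
    the restrictions of C to V1 form a code for cl1, and the words of C with a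
    given restriction to V1 form a code for cl2; the two upper bounds multiply
    to |C|, so both are attained. *)

Set Implicit Arguments.
Unset Strict Implicit.
Unset Printing Implicit Defensive.

(** * Partitions as fibres of functions *)

Section PreimPartition.
Variable T : finType.

Lemma mem_preim_partition (rT : eqType) (h : T -> rT) (B : {set T}) :
  reflect (exists x, B = [set y | h x == h y]) (B \in preim_partition h setT).
Proof.
have E x : [set y in [set: T] | h x == h y] = [set y | h x == h y].
  by apply/setP => y; rewrite !inE.
apply: (iffP imsetP) => [[x _ ->]|[x ->]]; exists x => //=; exact: E.
Qed.

Lemma preim_partition_sub (rT rT' : eqType) (h : T -> rT) (h' : T -> rT') :
  preim_partition h setT = preim_partition h' setT ->
  forall x y, h x = h y -> h' x = h' y.
Proof.
move=> E x y hxy.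
have /mem_preim_partition [z Bz] :
    [set y | h x == h y] \in preim_partition h' setT.
  by rewrite -E; apply/mem_preim_partition; exists x.
(* The [h]-fibre of [x] is the [h']-fibre of some [z], and it contains both [x] and [y]. *)
have [/setP/(_ x) + /setP/(_ y)] := (Bz, Bz).
by rewrite !inE hxy eqxx => /esym/eqP <- /esym/eqP.
Qed.

Lemma eq_preim_partition (rT rT' : eqType) (h : T -> rT) (h' : T -> rT') :
  (forall x y, h x = h y <-> h' x = h' y) ->
  preim_partition h setT = preim_partition h' setT.
Proof.
move=> E; have E' x : [set y | h x == h y] = [set y | h' x == h' y].
  by apply/setP => y; rewrite !inE; apply/eqP/eqP => /E.
by apply/setP => B; apply/mem_preim_partition/mem_preim_partition => -[x ->];
  exists x; rewrite E'.
Qed.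

Lemma preim_partition_id : preim_partition id setT = [set [set x] | x : T].
Proof.
apply/setP => B; apply/mem_preim_partition/imsetP => [[x ->]|[x _ ->]];
  by exists x => //; apply/setP => y; rewrite !inE eq_sym.
Qed.

Lemma card_preim_partition (A : finType) (h : T -> A) :
  #|preim_partition h setT| <= #|A|.
Proof.
pose F a := [set y | a == h y].
apply: leq_trans (leq_imset_card F A).
apply/subset_leq_card/subsetP => B /mem_preim_partition [x ->].
by apply/imsetP; exists (h x).
Qed.

(** The i-th part is labelled by the i-th letter. There are enough letters, so labels of parts are
    distinct and [a0], the default of [nth], is not reached on parts. *)
Lemma partition_preim (A : finType) (P : {set {set T}}) :
  0 < #|A| -> partition P setT -> #|P| <= #|A| ->
  exists h : T -> A, P = preim_partition h setT.
Proof.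
move=> /card_gt0P [a0 _] pP leP.
pose e B := nth a0 (enum A) (index B (enum P)).
have ltA B : B \in P -> index B (enum P) < size (enum A).
  move=> PB; rewrite -cardE; apply: leq_trans leP.
  by rewrite cardE index_mem mem_enum.
have e_inj : {in P &, injective e}.
  move=> B B' PB PB' /eqP; rewrite nth_uniq ?ltA ?enum_uniq // => /eqP.
  by apply: (index_inj B); rewrite mem_enum.
exists (e \o pblock P); rewrite -{1}(preim_partition_pblock pP).
have Pb x : pblock P x \in P by rewrite pblock_mem // (cover_partition pP).
by apply: eq_preim_partition => x y /=; split=> [->//|/e_inj]; apply.
Qed.

End PreimPartition.

(** * Solutions and codes of maximal size *)

Section Codes.
Variables (W A : finType).

(** Letters outside [X] are masked by [None], so that restrictions to all sets [X] share one
    type. *)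
Definition restrict (X : {set W}) (x : {ffun W -> A}) : {ffun W -> option A} :=
  [ffun v => if v \in X then Some (x v) else None].

Lemma restrictP (X : {set W}) x y :
  restrict X x = restrict X y <-> {in X, x =1 y}.
Proof.
split=> [/ffunP E v vX|E]; first by have := E v; rewrite !ffunE vX => -[].
by apply/ffunP => v; rewrite !ffunE; case: ifP => // /E ->.
Qed.

(** The part of the refinement through [x] is the intersection of the parts through [x], hence a
    fibre of the joint map to the letters at [X]. *)
Lemma refinement_preim (T : finType) (h : T -> {ffun W -> A})
    (f : W -> {set {set T}}) (X : {set W}) :
  (forall v, f v = preim_partition (fun x => h x v) setT) ->
  refinement f X = preim_partition (restrict X \o h) setT.
Proof.
move=> fE.
have capE x : [set y | (restrict X \o h) x == (restrict X \o h) y] =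
    \bigcap_(v in X) [set y | h x v == h y v].
  apply/setP => y; rewrite inE; apply/eqP/bigcapP => [/restrictP E v vX|E].
    by rewrite inE E.
  by apply/restrictP => v /E; rewrite inE => /eqP.
apply/setP => B; rewrite inE.
apply/andP/mem_preim_partition => [[/set0Pn [x Bx] /existsP [g]]|[x ->]].
  case/andP => /forall_inP gf /eqP EB; exists x; rewrite capE EB.
  apply: eq_bigr => v vX; have := gf v vX.
  rewrite fE => /mem_preim_partition [z gE].
  move: Bx; rewrite EB => /bigcapP /(_ v vX); rewrite gE inE => /eqP Ez.
  by apply/setP => y; rewrite !inE Ez.
split; first by apply/set0Pn; exists x; rewrite inE.
apply/existsP; exists [ffun v => [set y | h x v == h y v]].
apply/andP; split.
  apply/forall_inP => v _; rewrite fE ffunE.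
  by apply/mem_preim_partition; exists x.
by rewrite capE; apply/eqP/eq_bigr => v _; rewrite ffunE.
Qed.

Variable cl : closure_op W.

(** No size is imposed here, so that restrictions and fibres of codes are again codes; sizes are
    counted separately. *)
Definition is_code (C : {set {ffun W -> A}}) : Prop :=
  forall (X : {set W}) x y, x \in C -> y \in C ->
    {in X, x =1 y} -> {in cl X, x =1 y}.

Lemma cl_setT : cl setT = setT.
Proof. by apply/eqP; rewrite -subTset cl_ext. Qed.

Lemma cl_rank_le b : cl b = setT -> cl_rank cl <= #|b|.
Proof.
move=> clb; rewrite /cl_rank; case: arg_minnP; first by rewrite cl_setT.
by move=> b' _; apply; rewrite clb.
Qed.

Lemma cl_rank_ex : exists2 b, cl b = setT & #|b| = cl_rank cl.
Proof.
rewrite /cl_rank; case: arg_minnP; first by rewrite cl_setT.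
by move=> b /eqP clb _; exists b.
Qed.

(** A word of [C] is determined by its letters at a generating set of minimum size. *)
Lemma card_code C : is_code C -> #|C| <= #|A| ^ cl_rank cl.
Proof.
move=> codeC; have [b clb <-] := cl_rank_ex.
pose F (x : {ffun W -> A}) := [ffun i : 'I_#|b| => x (enum_val i)].
have F_inj : {in C &, injective F}.
  move=> x y Cx Cy /ffunP E; apply/ffunP => v.
  apply: (codeC b) => //; last by rewrite clb.
  move=> u bu; have := E (enum_rank_in bu u).
  by rewrite !ffunE enum_rankK_in.
have <- : #|{ffun 'I_#|b| -> A}| = #|A| ^ #|b| by rewrite card_ffun card_ord.
by rewrite -(card_in_imset F_inj) max_card.
Qed.

Lemma solvable_code : 0 < #|A| ->
  cl_solvable cl A <->
  exists2 C, is_code C & #|C| = #|A| ^ cl_rank cl.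
Proof.
move=> A_gt0; split=> [[f [[pf cf clf] fW]]|[C codeC cardC]].
  have [h fh] := fin_all_exists (fun v => partition_preim A_gt0 (pf v) (cf v)).
  pose H x := [ffun v => h v x].
  have fH v : f v = preim_partition (fun x => H x v) setT.
    by rewrite fh; apply: eq_preim_partition => x y; rewrite !ffunE.
  (* The refinement over all of [W] has singleton parts, so distinct tuples give distinct words. *)
  have H_inj : injective H.
    move=> x y Hxy; move: fW; rewrite (refinement_preim _ fH).
    rewrite -preim_partition_id => /preim_partition_sub; apply.
    by rewrite /= Hxy.
  exists (H @: setT); last by rewrite card_imset // cardsT card_tuple.
  move=> X ? ? /imsetP [x _ ->] /imsetP [y _ ->] E.
  have := clf X; rewrite !(refinement_preim _ fH) => /preim_partition_sub Hcl.
  by apply/restrictP/Hcl/restrictP.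
have cardT : #|{: (cl_rank cl).-tuple A}| = #|C| by rewrite card_tuple.
(* Any bijection from the tuples onto [C] would do; this one matches the two enumerations. *)
pose H x := enum_val (cast_ord cardT (enum_rank x)).
have HC x : H x \in C by apply: enum_valP.
have H_inj : injective H.
  by move=> x y /enum_val_inj/cast_ord_inj/enum_rank_inj.
pose f v := preim_partition (fun x => H x v) setT.
have fH v : f v = preim_partition (fun x => H x v) setT by [].
exists f; split; first split=> [v|v|X].
- exact: preim_partitionP.
- exact: card_preim_partition.
- rewrite !(refinement_preim _ fH); apply: eq_preim_partition => x y /=.
  split=> /restrictP E; apply/restrictP; first exact: codeC.
  by move=> v vX; apply: E; apply: (subsetP (cl_ext cl X)).
rewrite (refinement_preim _ fH) -preim_partition_id.
apply: eq_preim_partition => x y /=; split=> [/restrictP E|-> //].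
by apply/H_inj/ffunP => v; apply: E.
Qed.

End Codes.

Lemma is_code_sub (W A : finType) (cl cl' : closure_op W)
    (C : {set {ffun W -> A}}) :
  (forall X, cl' X \subset cl X) -> is_code cl C -> is_code cl' C.
Proof.
move=> sub codeC X x y Cx Cy E v /(subsetP (sub X)); exact: codeC.
Qed.

(** * Ranks of the two unions *)

Section Unions.
Variables (V1 V2 : finType) (cl1 : closure_op V1) (cl2 : closure_op V2).

Lemma card_join (S : {set V1}) (P : {set V2}) : #|join S P| = #|S| + #|P|.
Proof.
rewrite cardsU disjoint_setI0 ?cards0 ?subn0; last first.
  rewrite -setI_eq0; apply/eqP/setP => v; rewrite !inE.
  by apply/andP => -[/imsetP [u _ ->] /imsetP []].
by rewrite !card_imset // => ? ? [].
Qed.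

Lemma join_parts (X : {set V1 + V2}) : join (lpart X) (rpart X) = X.
Proof. by apply/setP => -[] v; rewrite ?mem_join_l ?mem_join_r inE. Qed.

Lemma join_setT (S : {set V1}) (P : {set V2}) :
  join S P = setT <-> S = setT /\ P = setT.
Proof.
split=> [E|[-> ->]]; last first.
  by apply/setP => -[] v; rewrite ?mem_join_l ?mem_join_r !inE.
split; first by rewrite -(lpart_join S P) E; apply/setP => v; rewrite !inE.
by rewrite -(rpart_join S P) E; apply/setP => v; rewrite !inE.
Qed.

(** Generating sets are exactly the joins of generating sets of the two sides, so minimum sizes
    add. *)
Lemma cl_rank_add (cl : closure_op (V1 + V2)%type) :
  (forall X, cl X = setT <->
     cl1 (lpart X) = setT /\ cl2 (rpart X) = setT) ->
  cl_rank cl = cl_rank cl1 + cl_rank cl2.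
Proof.
move=> clT; apply/eqP; rewrite eqn_leq; apply/andP; split.
  have [[b1 clb1 <-] [b2 clb2 <-]] := (cl_rank_ex cl1, cl_rank_ex cl2).
  by rewrite -card_join; apply/cl_rank_le/clT; rewrite lpart_join rpart_join.
have [b /clT [clb1 clb2] <-] := cl_rank_ex cl.
by rewrite -(join_parts b) card_join leq_add // cl_rank_le.
Qed.

Lemma cl_rank_dunion :
  cl_rank (disjoint_union cl1 cl2) = cl_rank cl1 + cl_rank cl2.
Proof. by apply: cl_rank_add => X; apply: join_setT. Qed.

Lemma cl_rank_uunion :
  cl_rank (unidirectional_union cl1 cl2) = cl_rank cl1 + cl_rank cl2.
Proof.
apply: cl_rank_add => X /=; rewrite /uunion_fun.
(* If the left part does not generate [V1], the closure misses a point of [V1], so both sides of the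
   equivalence fail. *)
case: eqP => [->|clX]; first exact: join_setT.
by split=> [/join_setT|] [].
Qed.

Lemma uunion_sub_dunion X :
  unidirectional_union cl1 cl2 X \subset disjoint_union cl1 cl2 X.
Proof.
rewrite /= /uunion_fun /dunion_fun.
by case: eqP => [->|_]; rewrite joinS ?cl_ext.
Qed.

Lemma uunion_join_l (S : {set V1}) (P : {set V2}) v :
  v \in cl1 S -> inl v \in unidirectional_union cl1 cl2 (join S P).
Proof.
rewrite /= /uunion_fun lpart_join.
by case: eqP => [->|_]; rewrite mem_join_l.
Qed.

Lemma uunion_join_r (P : {set V2}) v :
  v \in cl2 P -> inr v \in unidirectional_union cl1 cl2 (join setT P).
Proof.
by rewrite /= /uunion_fun lpart_join rpart_join cl_setT eqxx mem_join_r.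
Qed.

(** * Words on the union: products, restrictions and fibres *)

Variable A : finType.
Local Notation word := {ffun V1 + V2 -> A}.

Definition lword (x : word) : {ffun V1 -> A} := [ffun v => x (inl v)].
Definition rword (x : word) : {ffun V2 -> A} := [ffun v => x (inr v)].
Definition glue (p : {ffun V1 -> A} * {ffun V2 -> A}) : word :=
  [ffun v => match v with inl u => p.1 u | inr u => p.2 u end].

Lemma glue_inj : injective glue.
Proof.
move=> [x1 x2] [y1 y2] /ffunP E; congr pair; apply/ffunP => v.
  by have := E (inl v); rewrite !ffunE.
by have := E (inr v); rewrite !ffunE.
Qed.

Lemma lrword_inj x y : lword x = lword y -> rword x = rword y -> x = y.
Proof.
move=> /ffunP El /ffunP Er; apply/ffunP => -[] v.
  by have := El v; rewrite !ffunE.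
by have := Er v; rewrite !ffunE.
Qed.

Lemma is_code_glue C1 C2 : is_code cl1 C1 -> is_code cl2 C2 ->
  is_code (disjoint_union cl1 cl2) (glue @: setX C1 C2).
Proof.
move=> code1 code2 X _ _ /imsetP [[x1 x2] + ->] /imsetP [[y1 y2] + ->] E.
rewrite !inE /= => /andP [Cx1 Cx2] /andP [Cy1 Cy2] [] v;
  rewrite ?mem_join_l ?mem_join_r !ffunE /=.
  apply: code1 => // u; rewrite inE => /E; by rewrite !ffunE.
apply: code2 => // u; rewrite inE => /E; by rewrite !ffunE.
Qed.

(** On the [V1] side the closure depends only on the left part, so the right part may be taken
    empty. *)
Lemma is_code_lword C : is_code (unidirectional_union cl1 cl2) C ->
  is_code cl1 (lword @: C).
Proof.
move=> codeC X _ _ /imsetP [x Cx ->] /imsetP [y Cy ->] E v clv.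
rewrite !ffunE; apply: (codeC (join X set0)) => //; last exact: uunion_join_l.
move=> [] u; rewrite ?mem_join_l ?mem_join_r ?inE // => /E.
by rewrite !ffunE.
Qed.

(** Words with the same restriction to [V1] agree on all of [V1], and adding [V1] to a set is what
    activates [cl2]. *)
Lemma is_code_rword C z : is_code (unidirectional_union cl1 cl2) C ->
  is_code cl2 (rword @: [set x in C | lword x == z]).
Proof.
move=> codeC X _ _ /imsetP [x + ->] /imsetP [y + ->] E v clv.
rewrite !inE => /andP [Cx /eqP xz] /andP [Cy /eqP yz].
rewrite !ffunE; apply: (codeC (join setT X)) => //; last exact: uunion_join_r.
move=> [] u; rewrite ?mem_join_l ?mem_join_r => uX; last first.
  by have := E u uX; rewrite !ffunE.
by move: xz; rewrite -yz => /ffunP /(_ u); rewrite !ffunE.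
Qed.

Lemma card_lword_rword (C : {set word}) :
  #|C| = \sum_(z in lword @: C) #|rword @: [set x in C | lword x == z]|.
Proof.
rewrite -sum1_card (partition_big_imset lword) /=.
apply: eq_bigr => z _; rewrite card_in_imset.
  by rewrite -sum1_card; apply: eq_bigl => x; rewrite inE.
move=> x y; rewrite !inE => /andP [_ /eqP xz] /andP [_ /eqP yz].
by apply: lrword_inj; rewrite xz.
Qed.

End Unions.

Theorem corollary3 (V1 V2 : finType) (cl1 : closure_op V1) (cl2 : closure_op V2)
    (A : finType) (hA : 2 <= #|A|) :
  [<-> cl_solvable cl1 A /\ cl_solvable cl2 A;
       cl_solvable (disjoint_union cl1 cl2) A;
       cl_solvable (unidirectional_union cl1 cl2) A].
Proof.
have A_gt0 : 0 < #|A| by apply: ltnW.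
tfae.
- case=> /(solvable_code _ A_gt0) [C1 code1 card1].
  move=> /(solvable_code _ A_gt0) [C2 code2 card2].
  apply/(solvable_code _ A_gt0); exists (@glue _ _ _ @: setX C1 C2).
    exact: is_code_glue.
  rewrite (card_imset _ (@glue_inj _ _ _)) cardsX card1 card2.
  by rewrite cl_rank_dunion expnD.
- move=> /(solvable_code _ A_gt0) [C codeC cardC].
  apply/(solvable_code _ A_gt0); exists C.
    exact: is_code_sub (@uunion_sub_dunion _ _ cl1 cl2) codeC.
  by rewrite cardC cl_rank_dunion cl_rank_uunion.
move=> /(solvable_code _ A_gt0) [C codeC].
rewrite cl_rank_uunion expnD card_lword_rword.
have code1 := is_code_lword codeC; have le1 := card_code code1.
set C1 := _ @: C in code1 le1 *.
set D := fun z => @rword _ _ A @: [set x in C | lword x == z].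
have code2 z : is_code cl2 (D z) := is_code_rword codeC.
(* The equality case is carried along: summed over [C1], it tells when every fibre is full. *)
have le2 z : z \in C1 -> #|D z| <= #|A| ^ cl_rank cl2
    ?= iff (#|D z| == #|A| ^ cl_rank cl2).
  by move=> _; apply/leqif_eq/card_code.
have [leD eqD] := leqif_sum le2.
rewrite sum_nat_const in leD eqD => sumD; rewrite sumD in leD eqD.
(* The lower bound follows from [leD] by cancelling the positive factor [#|A| ^ cl_rank cl2]. *)
have card1 : #|C1| = #|A| ^ cl_rank cl1.
  apply/eqP; rewrite eqn_leq le1 /=.
  by rewrite leq_pmul2r ?expn_gt0 ?A_gt0 // in leD.
have /card_gt0P [z Cz] : 0 < #|C1| by rewrite card1 expn_gt0 A_gt0.
split; apply/(solvable_code _ A_gt0); first by exists C1.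
(* The fibre bounds now sum exactly to the size of [C], so all are attained, in particular at
   [z]. *)
move: eqD; rewrite card1 eqxx => /esym/forall_inP/(_ z Cz)/eqP cardD.
by exists (D z).
Qed.
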